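(* Let $X$ be any $T_{3\frac12}$ topological space. (1) The following are equivalent: $X$ is $\Omega M$; $C_p(X)$ is $CFT$; $C_p(X)$ is $CDFT$. (2) The following are equivalent: $X$ is $\Omega M^+$; $C_p(X)$ is $CFT^+$; $C_p(X)$ is $CDFT^+$. (3) The following are equivalent: $X$ is $\Omega M^{+mark}$; $C_p(X)$ is $CFT^{+mark}$; $C_p(X)$ is $CDFT^{+mark}$.
   Context: $[S]^{<\omega}$ is the set of finite subsets of $S$. For families of sets $\mathcal A,\mathcal B$, the selection principle $S_{fin}(\mathcal A,\mathcal B)$ states: whenever $A_n\in\mathcal A$ for $n<\omega$, there exist $B_n\in[A_n]^{<\omega}$ with $\bigcup_{n<\omega}B_n\in\mathcal B$. In the game $G_{fin}(\mathcal A,\mathcal B)$, in each round $n<\omega$ Player I chooses $A_n\in\mathcal A$ and then Player II chooses $B_n\in[A_n]^{<\omega}$; II wins iff $\bigcup_{n<\omega}B_n\in\mathcal B$. A strategy for II is a function $\sigma$ with $\sigma(\langle A_0,\dots,A_n\rangle)\in[A_n]^{<\omega}$ for all $\langle A_0,\dots,A_n\rangle\in\mathcal A^{n+1}$, $n<\omega$; it is winning if $\bigcup_{n<\omega}\sigma(\langle A_0,\dots,A_n\rangle)\in\mathcal B$ for every sequence $\langle A_0,A_1,\dots\rangle\in\mathcal A^\omega$. A Markov strategy for II is a function $\sigma$ with $\sigma(A,n)\in[A]^{<\omega}$ for $A\in\mathcal A$, $n<\omega$; it is winning if $\bigcup_{n<\omega}\sigma(A_n,n)\in\mathcal B$ for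 every $\langle A_0,A_1,\dots\rangle\in\mathcal A^\omega$. If a property $P$ is defined by $S_{fin}(\mathcal A,\mathcal B)$, then $P^+$ means II has a winning strategy in $G_{fin}(\mathcal A,\mathcal B)$, and $P^{+mark}$ means II has a winning Markov strategy. An $\omega$-cover of $X$ is an open cover $\mathcal U$ such that every $F\in[X]^{<\omega}$ is contained in some $U\in\mathcal U$; $\Omega_X$ is the collection of $\omega$-covers of $X$; $\Omega M$ is $S_{fin}(\Omega_X,\Omega_X)$. For a space $Y$ and $y\in Y$, $\mathcal D_Y$ is the collection of dense subsets of $Y$, $\mathcal B_{Y,y}$ is the collection of $A\subseteq Y$ with $y\in\overline{A}$; $CFT_y$ is $S_{fin}(\mathcal B_{Y,y},\mathcal B_{Y,y})$ and $CDFT_y$ is $S_{fin}(\mathcal D_Y,\mathcal B_{Y,y})$. $Y$ is $CFT$ (resp. $CFT^+$, $CFT^{+mark}$) if $CFT_y$ (resp. $CFT_y^+$, $CFT_y^{+mark}$) holds for every $y\in Y$; likewise for $CDFT$, $CDFT^+$, $CDFT^{+mark}$. $T_{3\frac12}$ means completely regular Hausdorff. $C_p(X)$ is the space of continuous real-valued functions on $X$ with the topology of pointwise convergence. *)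

(* Defs.v *)
From mathcomp Require Import all_boot all_order all_algebra.
From mathcomp Require Import all_classical all_reals all_analysis.
Import numFieldNormedType.Exports.

Set Implicit Arguments.
Unset Strict Implicit.
Unset Printing Implicit Defensive.

Local Open Scope classical_set_scope.

Definition fin_subsets (T : Type) (A : set T) : set (set T) :=
  [set B | finite_set B /\ B `<=` A].

Definition S_fin (T : Type) (AA BB : set (set T)) : Prop :=
  forall A : nat -> set T, (forall n, AA (A n)) ->
    exists B : nat -> set T,
      (forall n, fin_subsets (A n) (B n)) /\ BB (\bigcup_n B n).

(* A strategy for Player II in the game G_fin(AA, BB) is encoded as a total
   function on finite sequences; only its values on nonempty sequences of
   elements of AA are constrained or ever used.  [mkseq A n.+1] is the sequence
   <A 0, ..., A n> of the moves of Player I up to round n. *)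
Definition is_strategy (T : Type) (AA : set (set T))
    (sigma : seq (set T) -> set T) : Prop :=
  forall (n : nat) (A : nat -> set T),
    (forall i, (i <= n)%N -> AA (A i)) ->
    fin_subsets (A n) (sigma (mkseq A n.+1)).

Definition winning_strategy (T : Type) (AA BB : set (set T))
    (sigma : seq (set T) -> set T) : Prop :=
  is_strategy AA sigma /\
  forall A : nat -> set T, (forall n, AA (A n)) ->
    BB (\bigcup_n sigma (mkseq A n.+1)).

Definition S_fin_plus (T : Type) (AA BB : set (set T)) : Prop :=
  exists sigma : seq (set T) -> set T, winning_strategy AA BB sigma.

Definition is_markov_strategy (T : Type) (AA : set (set T))
    (sigma : set T -> nat -> set T) : Prop :=
  forall (A : set T) (n : nat), AA A -> fin_subsets A (sigma A n).

Definition winning_markov_strategy (T : Type) (AA BB : set (set T))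
    (sigma : set T -> nat -> set T) : Prop :=
  is_markov_strategy AA sigma /\
  forall A : nat -> set T, (forall n, AA (A n)) ->
    BB (\bigcup_n sigma (A n) n).

Definition S_fin_mark (T : Type) (AA BB : set (set T)) : Prop :=
  exists sigma : set T -> nat -> set T, winning_markov_strategy AA BB sigma.

(* The whole space is allowed as a member of an omega-cover. *)
Definition omega_covers (X : topologicalType) : set (set (set X)) :=
  [set U | [/\ forall u, U u -> open u,
               cover U id = [set: X] &
               forall F : set X, finite_set F -> exists2 u, U u & F `<=` u]].

Definition dense_sets (Y : topologicalType) : set (set Y) :=
  [set A | dense A].

Definition closure_at (Y : topologicalType) (y : Y) : set (set Y) :=
  [set A | closure A y].

Definition OmegaM (X : topologicalType) : Prop :=
  S_fin (@omega_covers X) (@omega_covers X).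
Definition OmegaM_plus (X : topologicalType) : Prop :=
  S_fin_plus (@omega_covers X) (@omega_covers X).
Definition OmegaM_mark (X : topologicalType) : Prop :=
  S_fin_mark (@omega_covers X) (@omega_covers X).

Definition CFT (Y : topologicalType) : Prop :=
  forall y : Y, S_fin (closure_at y) (closure_at y).
Definition CFT_plus (Y : topologicalType) : Prop :=
  forall y : Y, S_fin_plus (closure_at y) (closure_at y).
Definition CFT_mark (Y : topologicalType) : Prop :=
  forall y : Y, S_fin_mark (closure_at y) (closure_at y).

Definition CDFT (Y : topologicalType) : Prop :=
  forall y : Y, S_fin (@dense_sets Y) (closure_at y).
Definition CDFT_plus (Y : topologicalType) : Prop :=
  forall y : Y, S_fin_plus (@dense_sets Y) (closure_at y).
Definition CDFT_mark (Y : topologicalType) : Prop :=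
  forall y : Y, S_fin_mark (@dense_sets Y) (closure_at y).

(* The library phrases complete regularity with [uniform_separator], which
   [uniform_separatorP] identifies with separation by a continuous function
   into the unit interval of the reals. *)
Definition T3half (X : topologicalType) : Prop :=
  completely_regular_space X /\ hausdorff_space X.

(* The subspace topology inherited from the product {ptws X -> R}. *)
Definition Cp (R : realType) (X : topologicalType) : topologicalType :=
  initial_topology (id : continuousType X R -> {ptws X -> R}).

(* Main.v *)
Require Import Defs.
From mathcomp Require Import all_boot all_order all_algebra.
From mathcomp Require Import all_classical all_reals all_analysis.
From mathcomp Require Import ring.
Import Order.TTheory GRing.Theory Num.Theory.
Import numFieldNormedType.Exports.

Set Implicit Arguments.
Unset Strict Implicit.
Unset Printing Implicit Defensive.

Local Open Scope classical_set_scope.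
Local Open Scope ring_scope.

(** Each of the three groups is a cycle of implications: omega-covers of X yield
    the closure property in C_p(X), which yields the density property, which
    yields omega-covers again.  The same argument works for the plain selection
    principle, for strategies and for Markov strategies, because in every case a
    move A of Player I in one game can be turned, using only A and the number of
    the round, into a move of Player I in another game, and a finite answer there
    can be pulled back to a finite answer to A.  [Sfin_transfer] extracts the
    three implications from such a translation, so each step of the cycle only
    has to supply the translation and check that winning is preserved.

    From omega-covers to the closure property at f ([closure_at_of_omega]): if f
    is in the closure of A, the open sets where a member g of A is within
    1/(n+1) of f form an omega-cover, and a selected set leads back to such a g.
    To conclude, every finite F has to be covered by selections from arbitrarily
    late rounds, since only these come with small errors.  This would fail if X
    itself were selected early.  When X is infinite, removing one arbitrary point
    from each of these sets still gives an omega-cover, all of whose members are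
    proper; adding to F a point missed by each of the finitely many early
    selections then forces a late one.  When X is finite, a member of A close to
    f on the whole of X can be picked directly in each round.

    From the closure property to the density property: a dense set has every
    point in its closure.

    From the density property at 0 to omega-covers ([omega_of_dense]): for an
    omega-cover U, the functions equal to 1 off some member of U are dense, by
    complete regularity ([Cp_interpolation]).  If the selected functions
    accumulate at 0, then for each finite F one of them is smaller than 1 on F,
    so the member of U attached to it contains F. *)

(** * Transferring the three selection properties *)

Definition Sfin_implications (T T' : Type) (AA BB : set (set T))
    (AA' BB' : set (set T')) : Prop :=
  [/\ S_fin AA' BB' -> S_fin AA BB,
      S_fin_plus AA' BB' -> S_fin_plus AA BB &
      S_fin_mark AA' BB' -> S_fin_mark AA BB].

(** Player I's moves are translated by [phi], Player II's answers are pulled back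
    by [psi], both round by round.  A strategy is transported by translating the
    whole history of Player I's moves before consulting the given strategy; as
    the i-th move is always translated in the same way, the histories met along
    one play are the initial segments of a single translated play. *)
Lemma Sfin_transfer (T T' : Type) (AA BB : set (set T)) (AA' BB' : set (set T'))
    (phi : nat -> set T -> set T') (psi : nat -> set T -> set T' -> set T) :
  (forall n A, AA A -> AA' (phi n A)) ->
  (forall n A B, AA A -> fin_subsets (phi n A) B ->
     fin_subsets A (psi n A B)) ->
  (forall A B, (forall n, AA (A n)) ->
     (forall n, fin_subsets (phi n (A n)) (B n)) ->
     BB' (\bigcup_n B n) -> BB (\bigcup_n psi n (A n) (B n))) ->
  Sfin_implications AA BB AA' BB'.
Proof.
move=> phiAA psifin win; split.
- move=> sel A AAA.
  have [B [Bfin BB'B]] := sel (fun n => phi n (A n)) (fun n => phiAA n _ (AAA n)).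
  by exists (fun n => psi n (A n) (B n)); split=> [n|]; [exact: psifin|exact: win].
- move=> [sigma [stratS winS]].
  pose hist s := mkseq (fun i => phi i (nth set0 s i)) (size s).
  have histE A n : hist (mkseq A n.+1) = mkseq (fun i => phi i (A i)) n.+1.
    rewrite /hist size_mkseq; apply/eq_in_map => i; rewrite mem_iota => /andP[_ ilt].
    by rewrite nth_mkseq.
  have lastE (A : nat -> set T) n : last set0 (mkseq A n.+1) = A n.
    by rewrite (last_nth set0) size_mkseq /= -[RHS](nth_mkseq set0 A (ltnSn n)).
  have finS A n : (forall i, (i <= n)%N -> AA (A i)) ->
      fin_subsets (phi n (A n)) (sigma (hist (mkseq A n.+1))).
    move=> AAA; rewrite histE; apply: (stratS n (fun i => phi i (A i))) => i ilen.
    exact/phiAA/AAA.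
  exists (fun s => psi (size s).-1 (last set0 s) (sigma (hist s))); split.
    move=> n A AAA; rewrite size_mkseq lastE; apply: psifin; first exact: AAA.
    exact: finS.
  move=> A AAA.
  rewrite (_ : (fun n => _) =
      (fun n => psi n (A n) (sigma (hist (mkseq A n.+1))))); last first.
    by apply/funext => n; rewrite size_mkseq lastE.
  apply: win => // [n|]; first exact: finS.
  have -> : (fun n => sigma (hist (mkseq A n.+1))) =
      (fun n => sigma (mkseq (fun i => phi i (A i)) n.+1)).
    by apply/funext => n; rewrite histE.
  by apply: (winS (fun i => phi i (A i))) => n; exact: phiAA.
- move=> [sigma [stratS winS]].
  exists (fun A n => psi n A (sigma (phi n A) n)); split.
    by move=> A n AAA; apply: psifin => //; apply: stratS; exact: phiAA.
  move=> A AAA; apply: win => // [n|]; first exact/stratS/phiAA.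
  by apply: (winS (fun i => phi i (A i))) => n; exact: phiAA.
Qed.

Lemma Sfin_antitone (T : Type) (AA AA' BB : set (set T)) :
  AA `<=` AA' -> Sfin_implications AA BB AA' BB.
Proof.
by move=> sub; apply: (@Sfin_transfer _ _ _ _ _ _ (fun=> id) (fun _ _ => id)).
Qed.

(** * Omega-covers and closures in C_p(X) *)

(** Covering follows from the condition on finite sets, applied to singletons. *)
Lemma omega_coverP (X : topologicalType) (U : set (set X)) :
  omega_covers U <-> (forall u, U u -> open u) /\
    (forall F, finite_set F -> exists2 u, U u & F `<=` u).
Proof.
split=> [[]//|[Uo Uf]]; split=> //; apply/seteqP; split=> // x _.
by have [u Uu /(_ x erefl) ux] := Uf _ (finite_set1 x); exists u.
Qed.

Lemma dense_closureP (Y : topologicalType) (D : set Y) :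
  dense D <-> forall y, closure D y.
Proof.
split=> [dD y B|clD O [y Oy] Oo].
  rewrite nbhsE => - [W [Wo Wy] WB].
  by have [z [Wz Dz]] := dD W (ex_intro _ y Wy) Wo; exists z; split=> //; exact: WB.
by have [z [Dz Oz]] := clD y O (open_nbhs_nbhs (conj Oo Oy)); exists z.
Qed.

Section Cp.
Variables (R : realType) (X : topologicalType).
Implicit Types (f g : Cp R X) (A : set (Cp R X)) (F : set X).

Lemma Cp_eval_continuous (x : X) : continuous (fun g : Cp R X => g x).
Proof.
move=> g; apply: (@continuous_comp _ _ _ (id : Cp R X -> {ptws X -> R})
  (fun h : {ptws X -> R} => h x)).
  exact: initial_continuous.
exact: (@proj_continuous X (fun=> R) x).
Qed.

(** The two implications say that the sets of functions uniformly close to f on a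
    finite set are neighbourhoods of f, and that they form a base.  The latter
    holds because the filter they generate converges to f at each point, hence
    in the product topology. *)
Lemma closure_CpP A f :
  closure A f <-> forall F (e : R), finite_set F -> 0 < e ->
    exists2 g, A g & forall x, F x -> `|g x - f x| < e.
Proof.
split=> [clA F e /finite_seqP[s ->] e0|approx B].
  suff /clA[g [Ag fg]] : nbhs f [set g : Cp R X | forall x, x \in s -> `|g x - f x| < e].
    by exists g.
  elim: s => [|x s IHs]; first by apply: filterS filterT => g _ x.
  have fx : nbhs f [set g : Cp R X | `|g x - f x| < e].
    have /cvgrPdist_lt/(_ e e0) := @Cp_eval_continuous x f.
    by apply: filterS => g; rewrite /= distrC.
  apply: filterS (filterI fx IHs) => g [gx gs] y.
  by rewrite inE => /orP[/eqP->//|]; exact: gs.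
pose D := [set p : set X * R | finite_set p.1 /\ 0 < p.2].
pose nb (p : set X * R) := [set g : {ptws X -> R} | forall x, p.1 x -> `|g x - f x| < p.2].
have FF : Filter (filter_from D nb).
  apply: filter_from_filter; first by exists (set0, 1); split.
  move=> [F e] [F' e'] [/= finF e0] [/= finF' e'0].
  exists (F `|` F', Num.min e e').
    by split; rewrite /= ?finite_setU// lt_min e0.
  move=> g gb; split=> x Fx; have := gb x; rewrite /= lt_min => h.
    by have /andP[] := h (or_introl Fx).
  by have /andP[] := h (or_intror Fx).
have cvgf : filter_from D nb --> (f : {ptws X -> R}).
  apply/pointwise_cvgP => x; apply/cvgrPdist_lt => e e0.
  exists ([set x], e); first by split=> //; exact: finite_set1.
  by move=> g /(_ x erefl) /=; rewrite distrC.
case=> _ [[V Vo <-] Vf VB].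
have [[F e] [/= finF e0] subV] : filter_from D nb V.
  by apply: cvgf; exact: open_nbhs_nbhs.
have [g Ag gf] := approx F e finF e0.
by exists g; split=> //; apply: VB; exact: (subV g).
Qed.

(** Induction on the points: the value at a new point x is corrected by adding a
    multiple of a function that is 1 at x and vanishes off U and at the points
    already treated, a closed set which does not contain x. *)
Lemma Cp_interpolation (hX : T3half X) (s : seq X) (U : set X) (h : X -> R) (c : R) :
  open U -> {subset s <= U} ->
  exists f, (forall x, x \in s -> f x = h x) /\ (forall x, ~ U x -> f x = c).
Proof.
case: hX => creg /hausdorff_accessible/accessible_finite_set_closed fcl Uo.
elim: s => [_|x s IHs sU].
  by exists (mkcts (@cst_continuous X R c) : continuousType X R).
have [y ys|f [fs fU]] := IHs.
  by apply: sU; rewrite inE ys orbT.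
have [xs|xs] := boolP (x \in s).
  by exists f; split=> // y; rewrite inE => /orP[/eqP->|]; exact: fs.
have clB : closed (~` U `|` [set` s]).
  by apply: closedU; [exact: open_closedC|exact: (fcl _ (finite_seq s))].
have xB : ~ (~` U `|` [set` s]) x.
  by case=> [|/=]; [apply; apply/set_mem/sU; rewrite inE eqxx|exact/negP].
have /(@uniform_separatorP _ R)[k [kc _ k0 k1]] := creg _ _ clB xB.
have kx : k x = 0 by apply: k0; exists x.
have kB y : (~` U `|` [set` s]) y -> k y = 1 by move=> By; apply: k1; exists y.
have gc : continuous (fun y => f y + (h x - f x) * (1 - k y)).
  move=> y; apply: cvgD; first exact: (@cts_fun _ _ (f : continuousType X R)).
  by apply: cvgM; [exact: cvg_cst|apply: cvgB; [exact: cvg_cst|exact: kc]].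
exists (mkcts gc : continuousType X R); split=> y /=.
  rewrite /mkcts inE => /orP[/eqP->|ys]; first by rewrite kx; ring.
  by rewrite (kB y (or_intror ys)) (fs y ys); ring.
by rewrite /mkcts => Uy; rewrite (kB y (or_introl Uy)) (fU y Uy); ring.
Qed.

(** * From omega-covers to closures *)

Definition near_set n f g := [set x | `|g x - f x| < n.+1%:R^-1].

Lemma open_near_set n f g : open (near_set n f g).
Proof.
apply: (@open_comp _ _ (fun x => `|g x - f x|) [set t | t < n.+1%:R^-1]); last exact: open_lt.
move=> x _; apply: cvg_norm; apply: cvgB; exact: (@cts_fun _ _ (_ : continuousType X R)).
Qed.

Lemma near_set_witness A f n F : closure A f -> finite_set F ->
  exists2 g, A g & F `<=` near_set n f g.
Proof. by move=> /closure_CpP clA finF; apply: clA => //; rewrite invr_gt0. Qed.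

(** The rounds have to be unbounded so that the errors tend to 0. *)
Lemma closure_near_sets A f :
  (forall F N, finite_set F ->
     exists n g, [/\ (N <= n)%N, A g & F `<=` near_set n f g]) ->
  closure A f.
Proof.
move=> H; apply/closure_CpP => F e finF e0.
have [N _ Ne] := near_infty_natSinv_lt (PosNum e0).
have [n [g [Nn Ag Fg]]] := H F N finF.
by exists g => // x /Fg gx; apply: lt_trans gx _; exact: (Ne n Nn).
Qed.

(** For finite X, closeness to f on all of X is a single condition, so one member
    of A per round suffices whatever is selected from the omega-cover {X}. *)
Lemma closure_at_of_omega_finite f : finite_set [set: X] ->
  Sfin_implications (closure_at f) (closure_at f) (@omega_covers X) (@omega_covers X).
Proof.
move=> finX; pose P n A := [set g | A g /\ [set: X] `<=` near_set n f g].
have Pn n A : closure_at f A -> P n A (xget f (P n A)).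
  by move=> clA; apply: xgetPex; have [g] := near_set_witness n clA finX; exists g.
apply: (@Sfin_transfer _ _ _ _ _ _ (fun _ _ => [set setT])
  (fun n A _ => [set xget f (P n A)])).
- move=> _ A clA; apply/omega_coverP; split=> [u ->|F _]; first exact: openT.
  by exists setT.
- move=> n A B clA _; split; first exact: finite_set1.
  by move=> _ ->; have [] := Pn n A clA.
- move=> A B clA _ _; apply: closure_near_sets => F N finF.
  exists N, (xget f (P N (A N))); split=> //; first by exists N.
  by move=> x _; have [_] := Pn N _ (clA N); exact.
Qed.

(** Deleting a point makes all members of the cover proper, so that finitely many
    of them can be excluded by finitely many extra points. *)
Lemma closure_at_of_omega_infinite f : accessible_space X -> infinite_set [set: X] ->
  Sfin_implications (closure_at f) (closure_at f) (@omega_covers X) (@omega_covers X).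
Proof.
move=> accX infX.
pose phi n A := [set V : set X | exists g x, A g /\ V = near_set n f g `\ x].
pose P n A (V : set X) := [set g | A g /\ V `<=` near_set n f g].
have PV n A V : phi n A V -> P n A V (xget f (P n A V)).
  by move=> [g [x [Ag ->]]]; apply: xgetPex; exists g; split=> // y [].
apply: (@Sfin_transfer _ _ _ _ _ _ phi
  (fun n A B => (fun V => xget f (P n A V)) @` B)).
- move=> n A clA; apply/omega_coverP; split=> [_ [g [x [_ ->]]]|F finF].
    apply: openI; first exact: open_near_set.
    exact/closed_openC/accessible_closed_set1.
  have [g Ag Fg] := near_set_witness n clA finF.
  (* The deleted point is taken outside F, which is possible as X is infinite. *)
  have [x [_ Fx]] := infinite_setN0 (infinite_setD infX finF).
  exists (near_set n f g `\ x); first by exists g, x.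
  by move=> y Fy; split; [exact: Fg|move=> /= yx; apply: Fx; rewrite -yx].
- move=> n A B clA [finB Bphi]; split; first exact: finite_image.
  by move=> _ [V BV <-]; have [] := PV n A V (Bphi V BV).
- move=> A B clA Bfin /omega_coverP[_ cov]; apply: closure_near_sets => F N finF.
  pose early := \bigcup_(n in `I_N) B n.
  have finE : finite_set early.
    by apply: bigcup_finite => [|n _]; [exact: finite_II|have [] := Bfin n].
  have missed V : early V -> exists x, ~ V x.
    by move=> [n _ /(proj2 (Bfin n))[g [x [_ ->]]]]; exists x => -[_]; exact.
  have [x0 _] := infinite_setN0 infX.
  pose w V := xget x0 (~` V).
  have [V [n _ BV] FV] : exists2 V, (\bigcup_n B n) V & F `|` w @` early `<=` V.
    by apply: cov; rewrite finite_setU; split=> //; exact: finite_image.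
  have [Ag Vg] := PV n _ V (proj2 (Bfin n) V BV).
  exists n, (xget f (P n (A n) V)); split; [|by exists n => //; exists V|].
    rewrite leqNgt; apply/negP => nN.
    have EV : early V by exists n.
    by apply: (xgetPex x0 (missed V EV)); apply: FV; right; exists V.
  by move=> x Fx; apply: Vg; apply: FV; left.
Qed.

Lemma closure_at_of_omega f : accessible_space X ->
  Sfin_implications (closure_at f) (closure_at f) (@omega_covers X) (@omega_covers X).
Proof.
move=> accX; have [finX|infX] := pselect (finite_set [set: X]).
  exact: closure_at_of_omega_finite.
exact: closure_at_of_omega_infinite.
Qed.

(** * From dense sets to omega-covers *)

(** A function of absolute value less than 1 on F cannot take the value 1 there,
    so F lies in the member of the cover off which the function is 1. *)
Lemma omega_of_dense (hX : T3half X) :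
  Sfin_implications (@omega_covers X) (@omega_covers X)
    (@dense_sets (Cp R X)) (closure_at (mkcts (@cst_continuous X R 0) : Cp R X)).
Proof.
pose P (U : set (set X)) g := [set u | U u /\ forall x, ~ u x -> g x = 1].
pose phi (n : nat) U := [set g : Cp R X | exists u, P U g u].
have PU n U g : phi n U g -> P U g (xget setT (P U g)) by exact: xgetPex.
apply: (@Sfin_transfer _ _ _ _ _ _ phi
  (fun n U B => (fun g => xget setT (P U g)) @` B)).
- move=> n U /omega_coverP[Uo Uf]; apply/dense_closureP => h.
  apply/closure_CpP => F e /finite_seqP[s ->] e0.
  have [u Uu su] := Uf _ (finite_seq s).
  have [|g [gs gu]] := @Cp_interpolation hX s u h 1 (Uo u Uu).
    by move=> x xs; apply/mem_set/su.
  by exists g => [|x /= /gs ->]; [exists u|rewrite subrr normr0].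
- move=> n U B _ [finB Bphi]; split; first exact: finite_image.
  by move=> _ [g Bg <-]; have [] := PU n U g (Bphi g Bg).
- move=> U B UO Bfin /closure_CpP cl0.
  apply/omega_coverP; split=> [_ [n _ [g Bg <-]]|F finF].
    have [Uu _] := PU n (U n) g (proj2 (Bfin n) g Bg).
    by have [Uo _ _] := UO n; exact: Uo.
  have [g [n _ Bg] gF] := cl0 F 1 finF ltr01.
  have [Uu gu] := PU n (U n) g (proj2 (Bfin n) g Bg).
  exists (xget setT (P (U n) g)); first by exists n => //; exists g.
  move=> x /gF; rewrite /= /mkcts /cst subr0 => gx; apply: contrapT => /gu g1.
  by move: gx; rewrite g1 normr1 ltxx.
Qed.

End Cp.

Theorem theorem22 (R : realType) (X : topologicalType) (hX : T3half X) :
  [/\ [<-> OmegaM X; CFT (Cp R X); CDFT (Cp R X)],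
      [<-> OmegaM_plus X; CFT_plus (Cp R X); CDFT_plus (Cp R X)] &
      [<-> OmegaM_mark X; CFT_mark (Cp R X); CDFT_mark (Cp R X)]].
Proof.
have accX : accessible_space X by apply: hausdorff_accessible; case: hX.
have OC (f : Cp R X) := closure_at_of_omega f accX.
have CD (f : Cp R X) : Sfin_implications (@dense_sets (Cp R X)) (closure_at f)
    (closure_at f) (closure_at f).
  by apply: Sfin_antitone => D /dense_closureP; exact.
have [DO DO_plus DO_mark] := omega_of_dense R hX.
split; tfae.
- by move=> O f; have [+ _ _] := OC f; exact.
- by move=> C f; have [+ _ _] := CD f; apply; exact: C.
- by move=> D; apply: DO; exact: D.
- by move=> O f; have [_ + _] := OC f; exact.
- by move=> C f; have [_ + _] := CD f; apply; exact: C.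
- by move=> D; apply: DO_plus; exact: D.
- by move=> O f; have [_ _ +] := OC f; exact.
- by move=> C f; have [_ _ +] := CD f; apply; exact: C.
- by move=> D; apply: DO_mark; exact: D.
Qed.
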